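(* If $G$ is a connected graph of order $n \ge 2$, then $\alpha_1(G) \ge 2$, with equality if and only if $G$ is a good graph, i.e. for every edge $uv \in E(G)$ we have $N_G[u] \cup N_G[v] = V(G)$.
   Context: All graphs are finite, simple and undirected. $N_G[v] = \{v\} \cup \{u \in V(G) : uv \in E(G)\}$ is the closed neighbourhood of $v$. An edge $uv$ of $G$ is a good edge if $N_G[u] \cup N_G[v] = V(G)$; $G$ is a good graph if every edge of $G$ is a good edge. For $S \subseteq V(G)$, $\langle S\rangle_G$ denotes the induced subgraph. A $1$-nearly vertex independent set of $G$ is a set $S \subseteq V(G)$ such that $\langle S\rangle_G$ has exactly one edge, and $\alpha_1(G)$ is the maximum cardinality of such a set. *)

(* Defs.v *)
From mathcomp Require Import all_boot.

Set Implicit Arguments.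
Unset Strict Implicit.
Unset Printing Implicit Defensive.

Record sgraph := SGraph {
  vertex :> finType;
  adj : rel vertex;
  adj_sym : symmetric adj;
  adj_irrefl : irreflexive adj
}.

Definition edges (G : sgraph) : {set {set G}} :=
  [set [set p.1; p.2] | p : G * G & adj p.1 p.2].

(* The empty graph counts as connected here. *)
Definition connected (G : sgraph) : Prop :=
  forall x y : G, connect (@adj G) x y.

Definition closed_nbh (G : sgraph) (v : G) : {set G} :=
  v |: [set u | adj u v].

Definition good_edge (G : sgraph) (u v : G) : Prop :=
  closed_nbh u :|: closed_nbh v = [set: G].

Definition good_graph (G : sgraph) : Prop :=
  forall u v : G, adj u v -> good_edge u v.

Section Induced.
Variables (G : sgraph) (S : {set G}).

Definition induced_adj : rel {x : G | x \in S} :=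
  fun x y => adj (val x) (val y).

Lemma induced_adj_sym : symmetric induced_adj.
Proof. by move=> x y; rewrite /induced_adj adj_sym. Qed.

Lemma induced_adj_irrefl : irreflexive induced_adj.
Proof. by move=> x; rewrite /induced_adj adj_irrefl. Qed.

Definition induced : sgraph := SGraph induced_adj_sym induced_adj_irrefl.

End Induced.

Definition nearly_indep1 (G : sgraph) (S : {set G}) : bool :=
  #|edges (induced S)| == 1.

(* If G has no edge then no such S exists and alpha1 G is 0. *)
Definition alpha1 (G : sgraph) : nat :=
  \max_(S : {set G} | nearly_indep1 S) #|S|.

(* Main.v *)
Require Import Defs.
From mathcomp Require Import all_boot.

(** The two ends of any edge form a 1-nearly independent set, and a connected graph with two
    vertices has an edge; this gives the lower bound. A third vertex [w] can be added to the ends of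
    [uv] without creating an edge exactly when [w] lies outside both closed neighbourhoods, that is,
    when [w] witnesses that [uv] is not good. So a bad edge yields a set of size 3
    ([alpha1_le2_good_graph]), while in a good graph nothing can be added
    ([good_graph_alpha1_le2]). *)

(** Edges of [induced S] are sets over a subtype; taking images under the injection [val] moves the
    uniqueness of the edge to [G], where the rest of the argument takes place. *)
Lemma nearly_indep1P (G : sgraph) (S : {set G}) :
  reflect (exists u v : G, [/\ u \in S, v \in S, adj u v &
             forall x y, x \in S -> y \in S -> adj x y ->
               [set x; y] = [set u; v]])
          (nearly_indep1 S).
Proof.
apply: (iffP cards1P) => [[e edgesE] | [u [v [Su Sv uv only_uv]]]].
  have: e \in edges (induced S) by rewrite edgesE set11.
  case/imsetP=> -[a b]; rewrite inE /= => ab e_ab.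
  exists (val a), (val b); split=> [|||x y Sx Sy xy] //; [exact: valP | exact: valP |].
  pose x' : induced S := exist _ x Sx; pose y' : induced S := exist _ y Sy.
  have: [set x'; y'] \in edges (induced S).
    by apply/imsetP; exists (x', y'); rewrite ?inE.
  rewrite edgesE e_ab => /set1P /(congr1 (fun A : {set induced S} => val @: A)).
  by rewrite !imsetU1 !imset_set1.
pose u' : induced S := exist _ u Su; pose v' : induced S := exist _ v Sv.
exists [set u'; v']; apply/setP=> A; rewrite inE; apply/imsetP/eqP => [[[x y]] | ->].
  rewrite inE /= => xy ->; apply: (imset_inj val_inj).
  by rewrite !imsetU1 !imset_set1; apply: only_uv => //; exact: valP.
by exists (u', v'); rewrite ?inE.
Qed.

Lemma adj_neq (G : sgraph) (u v : G) : adj u v -> u != v.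
Proof. by apply: contraTneq => ->; rewrite adj_irrefl. Qed.

Lemma nearly_indep1_edge (G : sgraph) (u v : G) :
  adj u v -> nearly_indep1 [set u; v].
Proof.
move=> uv; apply/nearly_indep1P; exists u, v; rewrite set21 set22.
split=> // x y /set2P[]-> /set2P[]->; rewrite ?adj_irrefl // => _;
  exact: setUC.
Qed.

Lemma nearly_indep1_nonneighbour (G : sgraph) (u v w : G) :
  adj u v -> w \notin closed_nbh u :|: closed_nbh v ->
  nearly_indep1 (w |: [set u; v]).
Proof.
rewrite !inE !negb_or => uv /andP[/andP[_ /negPf wu] /andP[_ /negPf wv]].
have [uw vw] : adj u w = false /\ adj v w = false by rewrite !(adj_sym _ w).
apply/nearly_indep1P; exists u, v; rewrite !inE !eqxx !orbT.
split=> // x y /setU1P[->|/set2P[]->] /setU1P[->|/set2P[]->];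
  rewrite ?adj_irrefl ?uw ?vw ?wu ?wv // => _; exact: setUC.
Qed.

Lemma leq_alpha1 (G : sgraph) (S : {set G}) :
  nearly_indep1 S -> #|S| <= alpha1 G.
Proof. exact: (@leq_bigmax_cond _ _ (fun S : {set G} => #|S|)). Qed.

Lemma alpha1_ge2 (G : sgraph) (u v : G) : adj u v -> 2 <= alpha1 G.
Proof.
move=> uv; have := leq_alpha1 _ _ (nearly_indep1_edge _ _ _ uv).
by rewrite cards2 (adj_neq _ _ _ uv).
Qed.

(** Any [w] in [S] is [u], [v] or a neighbour of one of them, as [uv] is good. *)
Lemma good_graph_alpha1_le2 (G : sgraph) : good_graph G -> alpha1 G <= 2.
Proof.
move=> good; apply/bigmax_leqP => S /nearly_indep1P[u [v [Su Sv uv only_uv]]].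
have /subset_leq_card: S \subset [set u; v]; last first.
  by rewrite cards2 (adj_neq _ _ _ uv).
apply/subsetP=> w Sw.
have: w \in closed_nbh u :|: closed_nbh v by rewrite good // inE.
rewrite in_set2 !inE => /orP[] /orP[-> // | wa]; rewrite ?orbT // -in_set2.
  (* The edge [wu] lies inside [S], so it is the edge [uv], and [w] is one of its ends. *)
  by rewrite -(only_uv _ _ Sw Su wa) set21.
by rewrite -(only_uv _ _ Sw Sv wa) set21.
Qed.

Lemma alpha1_le2_good_graph (G : sgraph) : alpha1 G <= 2 -> good_graph G.
Proof.
move=> le2 u v uv; apply/setP=> w; rewrite [RHS]inE; apply: contraTT le2 => Nw.
have := leq_alpha1 _ _ (nearly_indep1_nonneighbour _ _ _ _ uv Nw).
rewrite -ltnNge cardsU1 cards2 (adj_neq _ _ _ uv).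
(* The set has size 3 only if [w] is new, which holds because closed neighbourhoods contain their
   centres. *)
suff -> : w \notin [set u; v] by [].
by apply: contraNN Nw; rewrite !inE => /orP[]->; rewrite ?orbT.
Qed.

Lemma connected_edge (G : sgraph) :
  connected G -> 1 < #|G| -> exists u v : G, adj u v.
Proof.
move=> conn /card_gt1P[x [y [_ _ xy]]].
(* A path between distinct vertices is nonempty, and its first step is an edge. *)
case/connectP: (conn x y) => -[|z p] /=; first by move=> _ yx; rewrite yx eqxx in xy.
by case/andP=> xz _ _; exists x, z.
Qed.

Theorem theorem3 (G : sgraph) (n : nat) (hn : #|G| = n) (hn2 : 2 <= n)
    (hconn : connected G) :
  2 <= alpha1 G /\ (alpha1 G = 2 <-> good_graph G).
Proof.
have [|u [v /alpha1_ge2 ge2]] := connected_edge G hconn; first by rewrite hn.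
split=> //; split=> [E | good].
  by apply: alpha1_le2_good_graph; rewrite E.
by apply/eqP; rewrite eqn_leq good_graph_alpha1_le2.
Qed.
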